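(* Let $s,t\ge1$ and $l\ge3$ be integers, $k=s+t+2$, and let $F$ be the petal overlapped $l$-hyperflower with $t$ twins and center of size $s$. Then the adjacency spectrum of the subdivision hypergraph $S(F)$ consists of: (i) the eigenvalue $-\frac{k-2}{k-1}$ with multiplicity $l(t-1)$; (ii) the eigenvalue $-\frac{l(k-2)}{k-1}$ with multiplicity $s-1$; (iii) the four roots of $(k-1)^{3}\lambda^{4}-(k-1)^{2}(k-2)(ls+t+1-l)\lambda^{3}-(k-1)\{(ls+t+4)(k-1)^{2}+(3ls+lt+l+2t+2)(k-2)^{2}\}\lambda^{2}-\{2l(s+t+1)(k-2)^{3}+(3ls+lt+4l+2t+4)(k-1)^{2}(k-2)\}\lambda-2l(s+t+2)(k-1)(k-2)^{2}=0$; (iv) for each $j'=1,\dots,l-1$, with $\beta_{j'}=2\cos\frac{2\pi j'}{l}$, the three roots of $(k-1)^{2}\lambda^{3}-(k-1)(k-2)\{\beta_{j'}+(t-1)\}\lambda^{2}-\{t(k-1)^{2}+(\beta_{j'}+2)(k-1)^{2}+(\beta_{j'}+2)t(k-2)^{2}-\beta_{j'}(t-1)(k-2)^{2}\}\lambda-(\beta_{j'}+2)(k-1)(k-2)-2t(k-1)(k-2)=0$.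
   Context: A hypergraph consists of a finite vertex set and hyperedges, which are vertex subsets of size at least $2$. For a $k$-uniform hypergraph (all hyperedges of size $k$) with vertices $v_1,\dots,v_N$, the adjacency matrix $A$ has $A_{ij}=\frac{d_{ij}}{k-1}$ for $i\neq j$, where $d_{ij}$ is the number of hyperedges containing both $v_i$ and $v_j$, and $A_{ii}=0$; the adjacency spectrum is the multiset of eigenvalues of $A$. The petal overlapped $l$-hyperflower with $t$ twins and center of size $s$ has pairwise distinct vertices $w_1,\dots,w_s$, $v_1,\dots,v_l$, and $u^j_i$ ($i=1,\dots,t$, $j=1,\dots,l$), and hyperedges $e_j=\{w_1,\dots,w_s,u^j_1,\dots,u^j_t,v_j,v_{j+1}\}$ for $j=1,\dots,l$, with indices taken modulo $l$ ($v_{l+1}=v_1$); thus each petal $e_j$ shares the vertex $v_j$ with $e_{j-1}$ and $v_{j+1}$ with $e_{j+1}$, and the hypergraph is $(s+t+2)$-uniform. Subdivision of a hyperedge $e$ of cardinality $k$: add a new vertex $p_e$, delete $e$, and add the $k$ hyperedges $\{p_e\}\cup(e\setminus\{v\})$, $v\in e$. The subdivision hypergraph $S(H)$ is obtained by subdividing every hyperedge of $H$. *)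

(* Defs.v *)
From HB Require Import structures.
From mathcomp Require Import all_boot all_order all_algebra.
From mathcomp Require Import reals trigo.
From mathcomp Require Import complex.

Set Implicit Arguments.
Unset Strict Implicit.
Unset Printing Implicit Defensive.

Import Order.TTheory GRing.Theory Num.Theory.
Local Open Scope ring_scope.

Record hypergraph := Hypergraph {
  vertex :> finType;
  hyperedges : {set {set vertex}};
  hyperedges_size : forall e, e \in hyperedges -> (1 < #|e|)%N
}.

Definition uniform (k : nat) (H : hypergraph) : Prop :=
  forall e, e \in hyperedges H -> #|e| = k.

Definition codegree (H : hypergraph) (x y : H) : nat :=
  #|[set e in hyperedges H | (x \in e) && (y \in e)]|.

(* Meant for k-uniform H; the vertices are listed by enum_val. *)
Definition adjacency (R : realType) (k : nat) (H : hypergraph) : 'M[R]_#|H| :=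
  \matrix_(i, j) if i == j then 0
                 else (codegree (enum_val i) (enum_val j))%:R / (k%:R - 1).

(* The roots of p listed with multiplicity (for p != 0; the order of the list
   is unspecified, so such lists should only be compared up to perm_eq). *)
Definition roots_of (F : closedFieldType) (p : {poly F}) : seq F :=
  sval (closed_field_poly_normal p).

Lemma roots_ofE (F : closedFieldType) (p : {poly F}) :
  p = lead_coef p *: \prod_(z <- roots_of p) ('X - z%:P).
Proof. exact: svalP (closed_field_poly_normal p). Qed.

Definition complex_roots (R : realType) (p : {poly R}) : seq R[i] :=
  roots_of (map_poly (real_complex R) p).

Definition spectrum (R : realType) (n : nat) (A : 'M[R]_n) : seq R[i] :=
  complex_roots (char_poly A).

Definition hyperedge (H : hypergraph) := {e : {set H} | e \in hyperedges H}.

(* inr e is the new vertex p_e. *)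
Definition subdivided_edge (H : hypergraph) (e : hyperedge H) (v : H) :
    {set H + hyperedge H} :=
  inr e |: [set inl x | x in val e :\ v].

Definition subdivision_edges (H : hypergraph) : {set {set H + hyperedge H}} :=
  [set subdivided_edge e v | e : hyperedge H, v : H in val e].

Lemma card_subdivided_edge (H : hypergraph) (e : hyperedge H) (v : H) :
  v \in val e -> #|subdivided_edge e v| = #|val e|.
Proof.
move=> ve; rewrite cardsU1 card_imset; last exact: inl_inj.
rewrite (cardsD1 v (val e)) ve; congr addn.
by case: imsetP => // -[].
Qed.

Lemma subdivision_size (H : hypergraph) (f : {set H + hyperedge H}) :
  f \in subdivision_edges H -> (1 < #|f|)%N.
Proof.
case/imset2P=> e v _ ve ->; rewrite card_subdivided_edge //.
exact: hyperedges_size (valP e).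
Qed.

Definition subdivision (H : hypergraph) : hypergraph :=
  Hypergraph (@subdivision_size H).

Lemma subdivision_uniform (k : nat) (H : hypergraph) :
  uniform k H -> uniform k (subdivision H).
Proof.
move=> Hk f /imset2P[e v _ ve ->].
by rewrite card_subdivided_edge // Hk //; exact: valP e.
Qed.

Definition flower_vertex (s t l : nat) : finType := ('I_s + 'I_l + 'I_t * 'I_l)%type.

Definition center_vertex (s t l : nat) (i : 'I_s) : flower_vertex s t l :=
  inl (inl i).
Definition shared_vertex (s t l : nat) (j : 'I_l) : flower_vertex s t l :=
  inl (inr j).
Definition twin_vertex (s t l : nat) (i : 'I_t) (j : 'I_l) : flower_vertex s t l :=
  inr (i, j).

(* The indices run from 0 to l-1; ordS is the cyclic successor on 'I_l. *)
Definition petal (s t l : nat) (j : 'I_l) : {set flower_vertex s t l} :=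
  [set center_vertex t l i | i : 'I_s] :|: [set twin_vertex s i j | i : 'I_t]
    :|: [set shared_vertex s t j; shared_vertex s t (ordS j)].

Definition petals (s t l : nat) : {set {set flower_vertex s t l}} :=
  [set petal s t j | j : 'I_l].

Lemma card_petal (s t l : nat) (l_gt2 : (2 < l)%N) (j : 'I_l) :
  #|petal s t j| = (s + t + 2)%N.
Proof.
have jS : j != ordS j.
  apply/eqP => /(congr1 val) /= E; have := ltn_ord j.
  move: E; rewrite leq_eqVlt => E /orP[/eqP jl|jl]; last first.
    by move: E; rewrite modn_small // => /n_Sn.
  by move: E l_gt2; rewrite jl modnn => j0; rewrite -jl j0.
have inj_w : injective (@center_vertex s t l) by move=> i i' [].
have inj_u : injective (fun i : 'I_t => twin_vertex s i j) by move=> i i' [].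
rewrite /petal cardsU [in LHS]cardsU !disjoint_setI0 ?cards0 ?subn0.
- rewrite !card_imset // !card_ord cards2; congr (_ + _)%N.
  suff -> : shared_vertex s t j != shared_vertex s t (ordS j) by [].
  by apply: contra jS => /eqP[] {1}->.
- rewrite disjoints_subset; apply/subsetP => x; rewrite !inE.
  by case/orP=> /imsetP[i _ ->].
rewrite disjoints_subset; apply/subsetP => _ /imsetP[i _ ->].
by rewrite inE; apply/imsetP => -[].
Qed.

Lemma petals_size (s t l : nat) (l_gt2 : (2 < l)%N) e :
  e \in petals s t l -> (1 < #|e|)%N.
Proof. by case/imsetP=> j _ ->; rewrite (card_petal s t l_gt2) addn2. Qed.

Definition hyperflower (s t l : nat) (l_gt2 : (2 < l)%N) : hypergraph :=
  Hypergraph (@petals_size s t l l_gt2).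

Arguments hyperflower s t l l_gt2 : clear implicits.

Lemma hyperflower_uniform (s t l : nat) (l_gt2 : (2 < l)%N) :
  uniform (s + t + 2)%N (hyperflower s t l l_gt2).
Proof. by move=> e /imsetP[j _ ->]; rewrite (card_petal s t l_gt2). Qed.

Definition quartic (R : realType) (s t l : R) : {poly R} :=
  let k := s + t + 2 in
  (k - 1) ^+ 3 *: 'X^4
  - ((k - 1) ^+ 2 * (k - 2) * (l * s + t + 1 - l)) *: 'X^3
  - ((k - 1) * ((l * s + t + 4) * (k - 1) ^+ 2
       + (3 * l * s + l * t + l + 2 * t + 2) * (k - 2) ^+ 2)) *: 'X^2
  - (2 * l * (s + t + 1) * (k - 2) ^+ 3
       + (3 * l * s + l * t + 4 * l + 2 * t + 4) * (k - 1) ^+ 2 * (k - 2)) *: 'X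
  - (2 * l * (s + t + 2) * (k - 1) * (k - 2) ^+ 2)%:P.

Definition cubic (R : realType) (s t b : R) : {poly R} :=
  let k := s + t + 2 in
  (k - 1) ^+ 2 *: 'X^3
  - ((k - 1) * (k - 2) * (b + (t - 1))) *: 'X^2
  - (t * (k - 1) ^+ 2 + (b + 2) * (k - 1) ^+ 2 + (b + 2) * t * (k - 2) ^+ 2
       - b * (t - 1) * (k - 2) ^+ 2) *: 'X
  - ((b + 2) * (k - 1) * (k - 2))%:P
  - (2 * t * (k - 1) * (k - 2))%:P.

Definition beta (R : realType) (l j : nat) : R :=
  2 * cos (2 * pi * j%:R / l%:R).

(* Main.v *)
Require Import Defs.
From HB Require Import structures.
From mathcomp Require Import all_boot all_order all_algebra.
From mathcomp Require Import reals trigo.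
From mathcomp Require Import complex.
From mathcomp Require Import perm ring lra.

(* Let M be the incidence matrix of a k-uniform hypergraph H with diagonal
   degree matrix D, and let a = (k - 2) / (k - 1).  The adjacency matrix of the
   subdivision S(H) is the block matrix [a (M M^T - D), M; M^T, 0].  For generic
   x, a Schur complement and det(1 - A B) = det(1 - B A) turn det(x - A(S(H)))
   into
     x^|E| prod_v (x + a deg v) det(1 - (a + 1/x) M^T (x + a D)^-1 M),
   a determinant indexed by the hyperedges of H.  For the hyperflower this
   l x l matrix is circulant, hence diagonalised by the l-th roots of unity: the
   trivial character yields the quartic and the other ones the cubics, while the
   remaining powers of x + a and x + a l give the multiple eigenvalues. *)

Set Implicit Arguments.
Unset Strict Implicit.
Unset Printing Implicit Defensive.

Import Order.TTheory GRing.Theory Num.Theory.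
Local Open Scope ring_scope.
Local Open Scope complex_scope.

(** * Determinants and polynomials *)

(** Two listings of the same index type differ by a permutation applied to both rows and columns, so
    its sign enters squared. This permits leaving the [enum_val] order for one in which a matrix has
    blocks. *)
Lemma det_reindex (R : comNzRingType) (T : finType) (n m : nat)
    (e : 'I_n -> T) (e' : 'I_m -> T) (f : T -> T -> R) :
  bijective e -> bijective e' ->
  \det (\matrix_(i, j) f (e i) (e j)) = \det (\matrix_(i, j) f (e' i) (e' j)).
Proof.
move=> e_bij e'_bij.
have enm : n = m.
  by rewrite -[n]card_ord -[m]card_ord (bij_eq_card e_bij) (bij_eq_card e'_bij).
subst m; case: e'_bij => g e'K gK.
have ge_inj : injective (g \o e).
  by apply: inj_comp; [exact: can_inj gK | exact: bij_inj].
pose s := perm ge_inj.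
have -> : \matrix_(i, j) f (e i) (e j)
    = row_perm s (col_perm s (\matrix_(i, j) f (e' i) (e' j))).
  by apply/matrixP => i j; rewrite !mxE !permE /= !gK.
rewrite row_permE col_permE !det_mulmx !det_perm odd_permV mulrC -mulrA.
by rewrite -expr2 sqrr_sign mulr1.
Qed.

(** Both sides equal the determinant of the block matrix with identity diagonal blocks and [A], [B]
    off the diagonal, according to which of these two blocks is eliminated. *)
Lemma det_1subC (R : comNzRingType) (m n : nat) (A : 'M[R]_(m, n))
    (B : 'M[R]_(n, m)) : \det (1%:M - A *m B) = \det (1%:M - B *m A).
Proof.
transitivity (\det (block_mx 1%:M A B 1%:M)).
  have <- : block_mx (1%:M - A *m B) A 0 1%:M *m block_mx 1%:M 0 B 1%:M
      = block_mx 1%:M A B 1%:M.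
    by rewrite mulmx_block !(mulmx1, mul1mx, mul0mx, mulmx0) subrK !add0r.
  by rewrite det_mulmx det_ublock det_lblock !det1 !mulr1.
have <- : block_mx 1%:M 0 B (1%:M - B *m A) *m block_mx 1%:M A 0 1%:M
    = block_mx 1%:M A B 1%:M.
  by rewrite mulmx_block !(mulmx1, mul1mx, mul0mx, mulmx0, addr0) addrC subrK.
by rewrite det_mulmx det_ublock det_lblock !det1 mul1r !mulr1.
Qed.

(** Multiplying [p - q] by the product of ['X - z] over [s] gives a polynomial vanishing everywhere.
    In characteristic zero the naturals supply too many distinct roots unless it is zero. Hence
    finitely many poles of a rational formula may be ignored. *)
Lemma poly_eq_away (F : numDomainType) (s : seq F) (p q : {poly F}) :
  (forall x, x \notin s -> p.[x] = q.[x]) -> p = q.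
Proof.
move=> pq; apply/eqP; rewrite -subr_eq0; apply/eqP.
have := (monic_neq0 (monic_prod_XsubC s predT id)).
set d := \prod_(_ <- _) _ => d_neq0.
apply: (mulIf d_neq0); rewrite mul0r; set r := _ * d.
have rx x : r.[x] = 0.
  rewrite hornerM hornerD hornerN; have [xs|xs] := boolP (x \in s).
    by rewrite (eqP (_ : root d x)) ?mulr0 // root_prod_XsubC.
  by rewrite pq // subrr mul0r.
apply/eqP; apply: contraT => r_neq0.
have := @max_poly_roots _ r [seq i%:R | i <- iota 0 (size r)] r_neq0.
rewrite size_map size_iota ltnn => -> //.
  by apply/allP => x _; rewrite /root rx.
rewrite map_inj_uniq ?iota_uniq // => i j /eqP; rewrite eqr_nat; exact: eqP.
Qed.

(* Schur complement of the lower right block [x%:M], followed by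
   [det_1subC]. *)
Lemma det_incidence_block (F : fieldType) (n m : nat) (x a : F) (d : 'rV[F]_n)
    (M : 'M[F]_(n, m)) :
    x != 0 -> (forall i, x + a * d 0 i != 0) ->
  \det (block_mx (x%:M - a *: (M *m M^T - diag_mx d)) (- M) (- M^T) x%:M)
  = x ^+ m * \prod_i (x + a * d 0 i)
    * \det (1%:M - \matrix_(e, e')
        ((a + x^-1) * \sum_i (x + a * d 0 i)^-1 * (M i e * M i e'))).
Proof.
move=> x0 d0.
pose D := \row_i (x + a * d 0 i); pose D' := \row_i (x + a * d 0 i)^-1.
have DD' : diag_mx D *m diag_mx D' = 1%:M.
  rewrite mulmx_diag; apply/matrixP => i j; rewrite !mxE.
  by case: eqP => [->|//]; rewrite divff.
pose S := diag_mx D - (a + x^-1) *: (M *m M^T).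
transitivity (\det (block_mx S (- M) 0 x%:M)).
  (* Right multiplication by a block unitriangular matrix, of determinant 1, clears the lower left
     block. *)
  transitivity (\det (block_mx (x%:M - a *: (M *m M^T - diag_mx d)) (- M)
      (- M^T) x%:M *m block_mx 1%:M 0 (x^-1 *: M^T) 1%:M)).
    by rewrite det_mulmx det_lblock !det1 !mulr1.
  rewrite mulmx_block !(mulmx1, mul1mx, mul0mx, mulmx0) add0r add0r.
  congr (\det (block_mx _ _ _ _)); last first.
    by rewrite mul_scalar_mx scalerA mulfV // scale1r addNr.
  rewrite /S mulNmx -scalemxAr scalerDl scalerBr.
  suff -> : diag_mx D = x%:M + a *: diag_mx d.
    by rewrite !opprD !addrA opprK; congr (_ - _); rewrite addrAC.
  by apply/matrixP => i j; rewrite !mxE; case: eqP => [->|];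
    rewrite ?mulr0 ?addr0.
rewrite det_ublock det_scalar mulrC -mulrA; congr (_ * _).
(* Once [diag_mx D] is factored out, what remains is 1 minus a product through the hyperedges, and
   [det_1subC] shrinks it to size [m]. *)
have -> : S = diag_mx D *m (1%:M - (a + x^-1) *: diag_mx D' *m M *m M^T).
  by rewrite mulmxBr mulmx1 -!scalemxAl -scalemxAr !mulmxA DD' mul1mx.
rewrite det_mulmx det_diag det_1subC; congr (_ * _).
  by apply: eq_bigr => i _; rewrite mxE.
congr (\det (_ - _)); apply/matrixP => e e'; rewrite !mxE big_distrr;
  apply: eq_bigr => i _.
rewrite -scalemxAl !mxE (bigD1 i) //= !mxE eqxx big1 ?addr0.
  by rewrite mulr1n; ring.
by move=> j /negPf ji; rewrite !mxE eq_sym ji mulr0n mul0r.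
Qed.

(** * Circulant determinants by roots of unity *)

Lemma sum_geometric_unity (F : fieldType) (l : nat) (w : F) :
  w ^+ l = 1 -> w != 1 -> \sum_(i < l) w ^+ i = 0.
Proof.
move=> wl w1; apply: (mulfI (_ : w - 1 != 0)); first by rewrite subr_eq0.
by rewrite -subrX1 wl subrr mulr0.
Qed.

Lemma expr_ordS (F : nzRingType) (l : nat) (w : F) (j : 'I_l) :
  w ^+ l = 1 -> w ^+ ordS j = w ^+ j.+1.
Proof. by move=> wl; rewrite /= expr_mod. Qed.

(* The columns of [\matrix_(j, i) w ^+ (i * j)] are eigenvectors. *)
Lemma det_circulant (F : numFieldType) (l : nat) (w x y z : F) :
    w ^+ l = 1 -> (forall i, (0 < i < l)%N -> w ^+ i != 1) ->
  \det (\matrix_(i < l, j < l) (x *+ (i == j)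
          + y *+ (ordS i == j) + y *+ (i == ordS j) + z))
  = \prod_(i < l) (x + y * (w ^+ i + w ^- i) + (z *+ l) *+ (i == 0%N :> nat)).
Proof.
move=> wl w_prim.
have [->|l_gt0] := posnP l; first by rewrite det_mx00 big_ord0.
have w0 : w != 0.
  by apply: contra_eq_neq wl => ->; rewrite expr0n gtn_eqF // eq_sym oner_neq0.
set A := \matrix_(_, _) _.
pose P := \matrix_(j < l, i < l) (w ^+ i) ^+ j.
pose d := \row_(i < l)
  (x + y * (w ^+ i + w ^- i) + (z *+ l) *+ (i == 0%N :> nat)).
(* The constant part [z] acts on a column of [P] through the column sum, which survives only for the
   trivial character [i = 0]. *)
have sum_pow (i : 'I_l) : \sum_(j < l) (w ^+ i) ^+ j =
  l%:R *+ (i == 0%N :> nat).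
  have [->|i0] := eqVneq (val i) 0%N.
    under eq_bigr do rewrite expr0 expr1n.
    by rewrite sumr_const card_ord.
  rewrite sum_geometric_unity //; first by rewrite exprAC wl expr1n.
  by rewrite w_prim // lt0n i0 ltn_ord.
(* The Vandermonde nodes [w ^+ i] are distinct because [w] is a primitive root of unity; so [\det P]
   can be cancelled and no inverse of [P] is needed. *)
have P_unit : \det P != 0.
  have -> : P = Vandermonde l (\row_(i < l) w ^+ i).
    by apply/matrixP => i j; rewrite !mxE.
  rewrite det_Vandermonde prodf_seq_neq0; apply/allP => i _ /=.
  rewrite prodf_seq_neq0; apply/allP => j _ /=; apply/implyP => ij.
  rewrite !mxE -(subnK (ltnW ij)) exprD -[X in _ - X]mul1r -mulrBl.
  rewrite mulf_neq0 ?expf_neq0 // subr_eq0 w_prim // subn_gt0 ij.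
  exact: leq_ltn_trans (leq_subr _ _) (ltn_ord j).
apply: (mulIf P_unit); rewrite -det_mulmx.
suff -> : A *m P = P *m diag_mx d.
  rewrite det_mulmx det_diag mulrC; congr (_ * _).
  by apply: eq_bigr => i _; rewrite mxE.
apply/matrixP => j i; rewrite mul_mx_diag !mxE.
under eq_bigr do rewrite !mxE !mulrDl.
rewrite !big_split /= -big_distrr sum_pow /=.
have wiS : w ^+ i ^+ ordS j = w ^+ i * w ^+ i ^+ j.
  by rewrite expr_ordS ?exprS // exprAC wl expr1n.
rewrite (bigD1 j) //= eqxx big1 ?addr0; last first.
  by move=> k /negPf kj; rewrite eq_sym kj mul0r.
rewrite (bigD1 (ordS j)) //= eqxx big1 ?addr0; last first.
  by move=> k /negPf kj; rewrite eq_sym kj mul0r.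
rewrite (bigD1 (ord_pred j)) //= ord_predK eqxx big1 ?addr0; last first.
  move=> k /negPf kj; rewrite -[j]ord_predK (inj_eq (bij_inj (ordS_bij l))).
  by rewrite eq_sym kj mul0r.
rewrite wiS.
have wiP : w ^+ i ^+ ord_pred j = w ^- i * w ^+ i ^+ j.
  rewrite -{2}[j]ord_predK expr_ordS ?exprS; last by rewrite exprAC wl expr1n.
  by rewrite mulKf // expf_neq0.
rewrite wiP; case: eqP => [->|_]; rewrite ?mulr0n ?mulr1n.
  by rewrite !expr0 expr1n invr1 -mulr_natr; ring.
by ring.
Qed.

(** * Subdivision of a uniform hypergraph *)

Lemma subdivided_edge_inl (H : hypergraph) (e : hyperedge H) (v x : H) :
  (inl x \in subdivided_edge e v) = (x != v) && (x \in val e).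
Proof. by rewrite in_setU1 /= mem_imset ?inE //; exact: inl_inj. Qed.

Lemma subdivided_edge_inr (H : hypergraph) (e e' : hyperedge H) (v : H) :
  (inr e' \in subdivided_edge e v) = (e' == e).
Proof.
rewrite in_setU1; case: imsetP => [[]//|_]; rewrite orbF.
by apply/eqP/eqP => [[]|->].
Qed.

(** Hyperedges of the subdivision are in bijection with pairs of a hyperedge [e] and a vertex [v] of
    [e]: the new vertex reveals [e], and [v] is the one vertex of [e] left out. *)
Lemma codegree_subdivision (H : hypergraph) (X Y : subdivision H) :
  codegree X Y = (\sum_(e : hyperedge H)
    #|[set v in val e | (X \in subdivided_edge e v)
                        && (Y \in subdivided_edge e v)]|)%N.
Proof.
pose D := [set p : hyperedge H * H | (p.2 \in val p.1)
  && ((X \in subdivided_edge p.1 p.2) && (Y \in subdivided_edge p.1 p.2))].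
transitivity #|[set subdivided_edge p.1 p.2 | p in D]|.
  apply: eq_card => f; rewrite inE; apply/andP/imsetP.
    case=> /imset2P[e v _ ve ->] XY; exists (e, v) => //.
    by rewrite inE; apply/andP.
  case=> -[e v]; rewrite inE /= => /andP[ve XY] ->; split=> //.
  by apply/imset2P; exists e v.
rewrite card_in_imset; last first.
  move=> [e v] [e' v']; rewrite !inE /= => /andP[ve _] /andP[ve' _] E.
  have ee' : e = e' by apply/eqP; rewrite -(subdivided_edge_inr _ _ v') -E
                                   subdivided_edge_inr.
  subst e'; congr (_, _); apply/eqP; apply: contraT => vv'.
  by move: (subdivided_edge_inl e v v);
    rewrite E subdivided_edge_inl vv' ve eqxx.
rewrite -sum1_card; under [RHS]eq_bigr do rewrite -sum1_card.
by rewrite pair_big_dep; apply: eq_bigl => -[e v]; rewrite !inE.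
Qed.

(** The sum is an entry of M M^T for the incidence matrix M; for [x = y] it is the degree of [x]. *)
Lemma codegree_sum (H : hypergraph) (x y : H) :
  codegree x y = (\sum_(e : hyperedge H) ((x \in val e) && (y \in val e)))%N.
Proof.
transitivity #|[set val e | e in [set e : hyperedge H |
  (x \in val e) && (y \in val e)]]|.
  apply: eq_card => e; rewrite inE; apply/andP/imsetP => [[eH xy]|[f]].
    by exists (exist _ e eH); rewrite ?inE.
  by rewrite inE => ? ->; split=> //; exact: valP f.
rewrite (card_imset _ val_inj) -sum1_card.
by rewrite big_mkcond /=; apply: eq_bigr => e _; rewrite inE; case: (_ && _).
Qed.

(** In each hyperedge through [x] and [y], the omitted vertex can be any of the [k - 2] others. *)
Lemma codegree_subdivision_vv (k : nat) (H : hypergraph) (x y : H) :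
  uniform k H -> x != y ->
  @codegree (subdivision H) (inl x) (inl y) = ((k - 2) * codegree x y)%N.
Proof.
move=> Hk xy; rewrite codegree_subdivision codegree_sum big_distrr /=.
apply: eq_bigr => e _; rewrite -(Hk _ (valP e)).
have [/andP[xe ye]|xye] := boolP ((x \in val e) && (y \in val e)).
  rewrite /= muln1 (cardsD1 x (val e)) xe (cardsD1 y (val e :\ x)) !inE eq_sym
    xy ye.
  rewrite addnA addnC addnK; apply: eq_card => v.
  rewrite in_set !in_setD1 !subdivided_edge_inl xe ye !andbT
    (eq_sym v) (eq_sym v).
  by rewrite andbC -andbA andbCA.
rewrite muln0; apply: eq_card0 => v.
rewrite in_set !subdivided_edge_inl andbACA (negPf xye).
by rewrite !andbF.
Qed.

(** The omitted vertex can be any vertex of [e] but [x]. The factor [k - 1] cancels the denominator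
    of the adjacency matrix, leaving a plain incidence block. *)
Lemma codegree_subdivision_ve (k : nat) (H : hypergraph) (x : H)
    (e : hyperedge H) : uniform k H ->
  @codegree (subdivision H) (inl x) (inr e) = ((k - 1) * (x \in val e))%N.
Proof.
move=> Hk; rewrite codegree_subdivision (bigD1 e) //= big1 ?addn0; last first.
  move=> e' e'e; apply: eq_card0 => v.
  by rewrite in_set subdivided_edge_inr eq_sym (negPf e'e) !andbF.
rewrite -(Hk _ (valP e)); have [xe|xe] := boolP (x \in val e).
  rewrite /= muln1 (cardsD1 x (val e)) xe addKn; apply: eq_card => v.
  by rewrite in_set in_setD1 subdivided_edge_inl subdivided_edge_inr xe eqxx
    !andbT andbC eq_sym.
rewrite muln0; apply: eq_card0 => v.
by rewrite in_set subdivided_edge_inl (negPf xe) !andbF.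
Qed.

Lemma codegreeC (H : hypergraph) (x y : H) : codegree x y = codegree y x.
Proof. by rewrite /codegree; apply: eq_card => e;
  rewrite !inE [X in _ && X]andbC. Qed.

Lemma codegree_subdivision_ee (H : hypergraph) (e e' : hyperedge H) : e != e' ->
  @codegree (subdivision H) (inr e) (inr e') = 0%N.
Proof.
move=> ee'; rewrite codegree_subdivision big1 // => f _; apply: eq_card0 => v.
rewrite in_set !subdivided_edge_inr; case: eqP => [<-|]; last by rewrite andbF.
by rewrite eq_sym (negPf ee') !andbF.
Qed.

(** * Characteristic polynomial of a subdivision *)

Lemma horner_char_poly (R : comNzRingType) (n : nat) (A : 'M[R]_n) (x : R) :
  (char_poly A).[x] = \det (x%:M - A).
Proof.
rewrite -/(horner_eval x _) /char_poly -det_map_mx; congr (\det _).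
apply/matrixP => i j.
by rewrite !mxE rmorphB rmorphMn /=
  /horner_eval hornerX hornerC.
Qed.

Lemma char_poly_subdivision (R : realType) (k m : nat) (H : hypergraph)
    (E : 'I_m -> hyperedge H) (x : R[i]) :
    let a := (k%:R - 2) / (k%:R - 1) in
    (1 < k)%N -> uniform k H -> bijective E -> x != 0 ->
    (forall v : H, x + a * (codegree v v)%:R != 0) ->
  (map_poly (real_complex R) (char_poly (adjacency R k (subdivision H)))).[x]
  = x ^+ m * \prod_(v : H) (x + a * (codegree v v)%:R)
    * \det (1%:M - \matrix_(i, j) ((a + x^-1) * \sum_(v : H)
        (x + a * (codegree v v)%:R)^-1
        * ((v \in val (E i))%:R * (v \in val (E j))%:R))).
Proof.
move=> a k_gt1 Hk E_bij x0 d0.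
rewrite map_char_poly horner_char_poly.
pose f (X Y : subdivision H) : R[i] := if X == Y then x
  else - ((codegree X Y)%:R / (k%:R - 1)).
transitivity (\det (\matrix_(i < #|subdivision H|, j < #|subdivision H|)
    f (enum_val i) (enum_val j))).
  congr (\det _); apply/matrixP => i j; rewrite !mxE /f (inj_eq enum_val_inj).
  case: eqP => _; first by rewrite rmorph0 subr0.
  by rewrite mulr0n sub0r fmorph_div rmorphB rmorph1 !rmorph_nat.
(* The original vertices are listed first and the new ones after them, in the order given by [E]. *)
pose e (i : 'I_(#|H| + m)) : subdivision H :=
  match split i with inl i => inl (enum_val i) | inr j => inr (E j) end.
have e_bij : bijective e.
  case: E_bij => E' EK E'K.
  exists (fun X : H + hyperedge H => unsplit (match X with
    inl v => inl (enum_rank v) | inr g => inr (E' g) end)) => [i|X].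
    rewrite /e -[RHS](splitK i).
    by case: (split i) => j; rewrite ?enum_valK ?EK.
  by rewrite /e unsplitK; case: X => [v|g]; rewrite ?enum_rankK ?E'K.
rewrite (det_reindex f (enum_val_bij _) e_bij).
pose M : 'M[R[i]]_(#|H|, m) := \matrix_(i, j) (enum_val i \in val (E j))%:R.
pose d : 'rV[R[i]]_#|H| := \row_i (codegree (enum_val i) (enum_val i))%:R.
have sumM : M *m M^T = \matrix_(i, j) (codegree (enum_val i) (enum_val j))%:R.
  apply/matrixP => i j; rewrite [RHS]mxE codegree_sum natr_sum !mxE (reindex E)
    /=; last exact: onW_bij.
  by apply: eq_bigr => g _; rewrite !mxE -natrM mulnb.
have k1 : k%:R - 1 != 0 :> R[i].
  by rewrite subr_eq0 -(mulr1n 1) eqr_nat gtn_eqF.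
(* The diagonal of [M *m M^T] holds the degrees; subtracting [diag_mx d] restores the zero diagonal
   of the adjacency matrix. *)
have -> : \matrix_(i, j) f (e i) (e j)
    = block_mx (x%:M - a *: (M *m M^T - diag_mx d)) (- M) (- M^T) x%:M.
  apply/matrixP => i j; rewrite -(splitK i) -(splitK j) mxE /e !unsplitK.
  case: (split i) => {}i; case: (split j) => {}j; rewrite /f.
  - rewrite block_mxEul sumM !mxE (inj_eq (@inl_inj _ _)) (inj_eq enum_val_inj).
    case: eqP => [->|/eqP ij]; first by rewrite !mulr1n subrr mulr0 subr0.
    rewrite (codegree_subdivision_vv Hk) ?(inj_eq enum_val_inj) //.
    by rewrite !mulr0n sub0r subr0 natrM natrB //; congr (- _); rewrite mulrAC.
  - rewrite block_mxEur !mxE /= (codegree_subdivision_ve _ _ Hk).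
    by rewrite natrM natrB 1?ltnW // mulrAC divff // mul1r.
  - rewrite block_mxEdl !mxE /= codegreeC (codegree_subdivision_ve _ _ Hk).
    by rewrite natrM natrB 1?ltnW // mulrAC divff // mul1r.
  rewrite block_mxEdr !mxE (inj_eq (@inr_inj _ _)) (inj_eq (bij_inj E_bij)).
  case: eqP => [_|/eqP ij] //.
  by rewrite codegree_subdivision_ee ?(inj_eq (bij_inj E_bij)) // mul0r oppr0.
rewrite det_incidence_block //; last by move=> i; rewrite mxE.
have enumH := onW_bij predT (enum_val_bij H).
congr (_ * _ * _); first by rewrite (reindex _ enumH); apply: eq_bigr => i _;
  rewrite mxE.
congr (\det (_ - _)); apply/matrixP => i j; rewrite !mxE (reindex _ enumH).
by congr (_ * _); apply: eq_bigr => v _; rewrite !mxE.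
Qed.

(** * Roots of unity *)

(** This is the exponential of i x. *)
Definition cis (R : realType) (x : R) : R[i] := cos x +i* sin x.

Lemma cis_exp (R : realType) (x : R) (n : nat) : cis x ^+ n = cis (x *+ n).
Proof.
elim: n => [|n IHn]; first by rewrite expr0 mulr0n /cis cos0 sin0.
rewrite exprS IHn mulrS /cis cosD sinD; apply/eqP.
by rewrite eq_complex /= eqxx addrC mulrC [cos x * _]mulrC eqxx.
Qed.

Lemma cisV (R : realType) (x : R) : (cis x)^-1 = cis (- x).
Proof.
have E : cis x * cis (- x) = 1.
  apply/eqP; rewrite /cis cosN sinN eq_complex /= mulrN opprK.
  by rewrite -!expr2 cos2Dsin2 eqxx mulrN [sin x * _]mulrC addNr eqxx.
have x0 : cis x != 0 by apply: contra_eq_neq E => ->;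
  rewrite mul0r eq_sym oner_neq0.
by apply: (mulfI x0); rewrite E divff.
Qed.

(** The real part is 1 - 2 sin^2 x, and sin x is positive on the given interval. The doubled angle
    lets half the argument stay between 0 and [pi]. *)
Lemma cis_neq1 (R : realType) (x : R) : 0 < x < pi -> cis (x *+ 2) != 1.
Proof.
move=> /sin_gt0_pi sx; rewrite eq_complex /= negb_and cos_mulr2n cos2sin2.
apply/orP; left; apply: contraTneq sx => E; rewrite -leNgt.
have : sin x ^+ 2 = 0 by lra.
by move/eqP; rewrite sqrf_eq0 => /eqP ->.
Qed.

Lemma cis_unity (R : realType) (l : nat) : (0 < l)%N ->
  cis (pi / l%:R *+ 2 : R) ^+ l = 1.
Proof.
move=> l_gt0; rewrite cis_exp -mulrnA mulnC mulrnA -[_ *+ l]mulr_natr divfK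
  ?pnatr_eq0 -?lt0n //.
by rewrite /cis cos2pi sin2pi.
Qed.

Lemma cis_primitive (R : realType) (l i : nat) : (0 < i < l)%N ->
  cis (pi / l%:R *+ 2 : R) ^+ i != 1.
Proof.
case/andP=> i0 il; rewrite cis_exp -mulrnA mulnC mulrnA; apply: cis_neq1.
have l_gt0 : (0 < l)%N by exact: leq_trans il.
have l0 : 0 < l%:R :> R by rewrite ltr0n.
rewrite -[_ *+ i]mulr_natr mulr_gt0 ?divr_gt0 ?pi_gt0 ?ltr0n //=.
by rewrite mulrAC ltr_pdivrMr // ltr_pM2l ?pi_gt0 // ltr_nat.
Qed.

Lemma cis_beta (R : realType) (l i : nat) :
  cis (pi / l%:R *+ 2 : R) ^+ i + cis (pi / l%:R *+ 2 : R) ^- i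
  = (beta R l i)%:C.
Proof.
rewrite /beta; have -> : 2 * pi * i%:R / l%:R = pi / l%:R *+ 2 *+ i :> R.
  by rewrite -[RHS]mulr_natr; ring.
rewrite cis_exp cisV /cis cosN sinN; apply/eqP.
by rewrite eq_complex /= subrr eqxx andbT mulr_natl mulr2n.
Qed.

(** * The quartic and the cubics *)

(** Root lists are compared through their monic products; this makes the leading coefficients of the
    quartic and the cubics necessary. *)
Lemma prod_complex_roots (R : realType) (p : {poly R}) : p != 0 ->
  \prod_(z <- complex_roots p) ('X - z%:P)
  = ((lead_coef p)^-1)%:C *: map_poly (real_complex R) p.
Proof.
move=> p0; rewrite [in RHS](roots_ofE (map_poly _ p)) scalerA lead_coef_map.
by rewrite -rmorphM /= mulVf ?lead_coef_eq0 // scale1r.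
Qed.

Lemma lead_coef_quartic (R : realType) (s t l : R) : s + t + 2 - 1 != 0 ->
  lead_coef (quartic s t l) = (s + t + 2 - 1) ^+ 3.
Proof.
move=> k1; rewrite /quartic; set k := s + t + 2 in k1 *.
set c4 := (k - 1) ^+ 3; set c3 := (X in X *: 'X^3); set c2 := (X in X *: 'X^2).
set c1 := (X in X *: 'X); set c0 := (X in X%:P).
have c4_neq0 : c4 != 0 by rewrite expf_neq0.
have -> : c4 *: 'X^4 - c3 *: 'X^3 - c2 *: 'X^2 - c1 *: 'X - c0%:P
   (* Coefficients are listed from the constant term up, so the last entry is the leading
      coefficient as soon as it is nonzero. *)
   = Poly [:: - c0; - c1; - c2; - c3; c4].
  by rewrite /= !cons_poly_def -!mul_polyC; ring.
by rewrite lead_coefE (@PolyK _ 0).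
Qed.

Lemma lead_coef_cubic (R : realType) (s t b : R) : s + t + 2 - 1 != 0 ->
  lead_coef (cubic s t b) = (s + t + 2 - 1) ^+ 2.
Proof.
move=> k1; rewrite /cubic; set k := s + t + 2 in k1 *.
set c3 := (k - 1) ^+ 2; set c2 := (X in X *: 'X^2).
set c1 := (X in X *: 'X); set c0 := ((b + 2) * _ * _);
  set c0' := (2 * t * _ * _).
have c3_neq0 : c3 != 0 by rewrite expf_neq0.
have -> : c3 *: 'X^3 - c2 *: 'X^2 - c1 *: 'X - c0%:P - c0'%:P
   = Poly [:: - c0 - c0'; - c1; - c2; c3].
  by rewrite /= !cons_poly_def -!mul_polyC; ring.
by rewrite lead_coefE (@PolyK _ 0).
Qed.

(** The last factor is the circulant eigenvalue at the trivial character, where [beta] is 2 and the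
    center contributes [L] times its constant; the factors before it clear the denominators. *)
Lemma horner_quartic (R : realType) (s t l : R) (x : R[i]) :
    let S := s%:C in let T := t%:C in let L := l%:C in
    let k := S + T + 2 in let a := (k - 2) / (k - 1) in
    k - 1 != 0 -> x != 0 -> x + a * L != 0 -> x + a * 2 != 0 -> x + a != 0 ->
  (map_poly (real_complex R) (quartic s t l)).[x]
  = (k - 1) ^+ 3 * (x * (x + a * L) * (x + a * 2) * (x + a)
    * (1 - (a + x^-1) * (2 / (x + a * 2) + T / (x + a))
       - (a + x^-1) / (x + a * 2) * 2 - (a + x^-1) * S / (x + a * L) * L)).
Proof.
move=> S T L k a k1 x0 xl x2 x1.
(* With (k - 1)^3 taken out, the powers of [k - 1] and [k - 2] occur only through their quotient
   [a]. *)
transitivity ((k - 1) ^+ 3 * (x ^+ 4 - a * (L * S + T + 1 - L) * x ^+ 3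
   - (L * S + T + 4 + (3 * L * S + L * T + L + 2 * T + 2) * a ^+ 2) * x ^+ 2
   - (2 * L * (S + T + 1) * a ^+ 3
      + (3 * L * S + L * T + 4 * L + 2 * T + 4) * a) * x
   - 2 * L * (S + T + 2) * a ^+ 2)).
  rewrite /quartic.
  set c4 := (X in X *: 'X^4); set c3 := (X in X *: 'X^3).
  set c2 := (X in X *: 'X^2); set c1 := (X in X *: 'X); set c0 := (X in X%:P).
  rewrite !rmorphB /= !(map_polyZ, map_polyXn, map_polyX, map_polyC) /=.
  rewrite !(hornerD, hornerN, hornerZ, hornerXn, hornerX, hornerC).
  transitivity ((k - 1) ^+ 3 * x ^+ 4
    - (k - 1) ^+ 2 * (k - 2) * (L * S + T + 1 - L) * x ^+ 3
    - (k - 1) * ((L * S + T + 4) * (k - 1) ^+ 2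
       + (3 * L * S + L * T + L + 2 * T + 2) * (k - 2) ^+ 2) * x ^+ 2
    - (2 * L * (S + T + 1) * (k - 2) ^+ 3
       + (3 * L * S + L * T + 4 * L + 2 * T + 4) * (k - 1) ^+ 2 * (k - 2)) * x
    - 2 * L * (S + T + 2) * (k - 1) * (k - 2) ^+ 2).
    by rewrite /k /S /T /L /c4 /c3 /c2 /c1 /c0; ring.
  by rewrite /a; move: {xl x2 x1 a} k k1 => k k1; field.
(* The remaining identity holds with [a] as an independent variable, so its value is forgotten. *)
congr (_ * _); move: a xl x2 x1 => a xl x2 x1; field.
by rewrite xl x2 x1 x0.
Qed.

(** This is the eigenvalue at a nontrivial character: the constant coming from the center is
    annihilated there, hence no factor [x + a * l] and a degree lower by one. *)
Lemma horner_cubic (R : realType) (s t b : R) (x : R[i]) :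
    let S := s%:C in let T := t%:C in let B := b%:C in
    let k := S + T + 2 in let a := (k - 2) / (k - 1) in
    k - 1 != 0 -> x != 0 -> x + a * 2 != 0 -> x + a != 0 ->
  (map_poly (real_complex R) (cubic s t b)).[x]
  = (k - 1) ^+ 2 * (x * (x + a * 2) * (x + a)
    * (1 - (a + x^-1) * (2 / (x + a * 2) + T / (x + a))
       - (a + x^-1) / (x + a * 2) * B)).
Proof.
move=> S T B k a k1 x0 x2 x1.
transitivity ((k - 1) ^+ 2 * (x ^+ 3 - a * (B + (T - 1)) * x ^+ 2
   - (T + (B + 2) + (B + 2) * T * a ^+ 2 - B * (T - 1) * a ^+ 2) * x
   - (B + 2) * a - 2 * T * a)).
  rewrite /cubic.
  set c3 := (X in X *: 'X^3); set c2 := (X in X *: 'X^2).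
  set c1 := (X in X *: 'X); set c0 := ((b + 2) * _ * _);
    set c0' := (2 * t * _ * _).
  rewrite !rmorphB /= !(map_polyZ, map_polyXn, map_polyX, map_polyC) /=.
  rewrite !(hornerD, hornerN, hornerZ, hornerXn, hornerX, hornerC).
  transitivity ((k - 1) ^+ 2 * x ^+ 3 - (k - 1) * (k - 2) * (B + (T - 1))
      * x ^+ 2
    - (T * (k - 1) ^+ 2 + (B + 2) * (k - 1) ^+ 2 + (B + 2) * T * (k - 2) ^+ 2
       - B * (T - 1) * (k - 2) ^+ 2) * x
    - (B + 2) * (k - 1) * (k - 2) - 2 * T * (k - 1) * (k - 2)).
    by rewrite /k /S /T /B /c3 /c2 /c1 /c0 /c0'; ring.
  by rewrite /a; move: {x2 x1 a} k k1 => k k1; field.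
congr (_ * _); move: a x2 x1 => a x2 x1; field.
by rewrite x2 x1 x0.
Qed.

(** * The hyperflower *)

Lemma center_mem_petal (s t l : nat) (i : 'I_s) (j : 'I_l) :
  center_vertex t l i \in petal s t j.
Proof. by rewrite !inE imset_f. Qed.

Lemma shared_mem_petal (s t l : nat) (i j : 'I_l) :
  (shared_vertex s t i \in petal s t j) = (i == j) || (i == ordS j).
Proof.
rewrite !inE; case: imsetP => [[]//|_]; case: imsetP => [[]//|_] /=.
by [].
Qed.

Lemma twin_mem_petal (s t l : nat) (i : 'I_t) (i' j : 'I_l) :
  (twin_vertex s i i' \in petal s t j) = (i' == j).
Proof.
rewrite !inE; case: imsetP => [[]//|_]; rewrite !orbF /=.
by apply/imsetP/eqP => [[? _ [_ ->]]|->] //; exists i.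
Qed.

(** A twin lies in exactly one petal and so identifies it. *)
Lemma petal_inj (s t l : nat) : (0 < t)%N -> injective (@petal s t l).
Proof.
case: t => // t _ j j' E; apply/eqP; rewrite -(twin_mem_petal s (@ord0 t)) -E.
by rewrite twin_mem_petal.
Qed.

Lemma petal_hyperedge (s t l : nat) (l_gt2 : (2 < l)%N) (j : 'I_l) :
  petal s t j \in hyperedges (hyperflower s t l l_gt2).
Proof. exact: imset_f. Qed.

Definition petal_edge (s t l : nat) (l_gt2 : (2 < l)%N) (j : 'I_l) :
    hyperedge (hyperflower s t l l_gt2) :=
  exist _ (petal s t j) (petal_hyperedge s t l_gt2 j).

Lemma petal_edge_bij (s t l : nat) (l_gt2 : (2 < l)%N) : (0 < t)%N ->
  bijective (@petal_edge s t l l_gt2).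
Proof.
move=> t_gt0; apply: inj_card_bij => [j j' /(congr1 val)/(petal_inj t_gt0)//|].
rewrite card_sig card_ord /= -[leqRHS]card_ord.
exact: leq_trans (leq_imset_card _ _) (max_card _).
Qed.

Lemma ordS_neq (l : nat) (j : 'I_l) : (1 < l)%N -> ordS j != j.
Proof.
move=> l_gt1; apply/eqP => /(congr1 val) /= E; have := ltn_ord j.
rewrite leq_eqVlt => /orP[/eqP jl|jl]; last first.
  by move: E; rewrite modn_small // => /esym/n_Sn.
by move: E l_gt1; rewrite jl modnn => j0; rewrite -jl -j0.
Qed.

Lemma degree_hyperflower (s t l : nat) (l_gt2 : (2 < l)%N) : (0 < t)%N ->
  forall v : hyperflower s t l l_gt2, codegree v v
  = match v with inl (inl _) => l | inl (inr _) => 2%N | inr _ => 1%N end.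
Proof.
move=> t_gt0 v; rewrite codegree_sum.
rewrite (reindex _ (onW_bij _ (petal_edge_bij s l_gt2 t_gt0))) /=.
under eq_bigr do rewrite andbb.
case: v => [[i|i]|[i i']].
- under eq_bigr do rewrite -/(center_vertex t l i) center_mem_petal.
  by rewrite sum1_card card_ord.
- under eq_bigr do rewrite -/(shared_vertex s t i) shared_mem_petal.
  (* The shared vertex [i] lies in petal [i] and in the preceding one, which are distinct. *)
  rewrite (bigD1 i) //= eqxx (bigD1 (ord_pred i)) /=; last first.
    by rewrite -(inj_eq (bij_inj (ordS_bij l))) ord_predK eq_sym ordS_neq //
      ltnW.
  rewrite ord_predK eqxx orbT big1 // => j /andP[ji jpi].
  rewrite eq_sym (negPf ji) /= -{1}(ord_predK i)
    (inj_eq (bij_inj (ordS_bij l))).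
  by rewrite eq_sym (negPf jpi).
under eq_bigr do rewrite -/(twin_vertex s i i') twin_mem_petal.
rewrite (bigD1 i') //= eqxx big1 // => j /negPf; by rewrite eq_sym => ->.
Qed.

Lemma sum_delta (R : comNzRingType) (l : nat) (p q : 'I_l) :
  \sum_(v < l) (v == p)%:R * (v == q)%:R = (p == q)%:R :> R.
Proof.
rewrite (bigD1 p) //= eqxx mul1r big1 ?addr0 // => v /negPf ->.
by rewrite mul0r.
Qed.

(** The degrees [l], 2 and 1 of center, shared and twin vertices give the three denominators. Two
    petals always meet in the center, cyclically consecutive ones also in a shared vertex, so the
    matrix on petals is circulant. *)
Lemma horner_char_poly_hyperflower (R : realType) (s t l : nat)
    (l_gt2 : (2 < l)%N) (x : R[i]) :
    let k := (s + t + 2)%N in let a := (k%:R - 2) / (k%:R - 1) in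
    (0 < t)%N -> x != 0 -> x + a * l%:R != 0 -> x + a * 2 != 0 -> x + a != 0 ->
  (map_poly (real_complex R) (char_poly
     (adjacency R k (subdivision (hyperflower s t l l_gt2))))).[x]
  = x ^+ l * ((x + a * l%:R) ^+ s * (x + a * 2) ^+ l * (x + a) ^+ (t * l))
    * \prod_(j < l) (1 - (a + x^-1) * (2 / (x + a * 2) + t%:R / (x + a))
       - (a + x^-1) / (x + a * 2) * (beta R l j)%:C
       - ((a + x^-1) * s%:R / (x + a * l%:R) *+ l) *+ (j == 0%N :> nat)).
Proof.
move=> k a t_gt0 x0 xl x2 x1.
have deg := @degree_hyperflower s t l l_gt2 t_gt0.
rewrite (char_poly_subdivision _ _ (petal_edge_bij s l_gt2 t_gt0)) //;
  last first.
- by case=> [[i|i]|i]; rewrite deg ?mulr1.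
- exact: hyperflower_uniform.
- by rewrite /k addn2.
rewrite -/a; move: a xl x2 x1 => a xl x2 x1.
congr (_ * _ * _).
  rewrite !big_sumType /=; congr (_ * _ * _).
  - under eq_bigr do rewrite deg.
    by rewrite prodr_const card_ord.
  - under eq_bigr do rewrite deg.
    by rewrite prodr_const card_ord.
  under eq_bigr do rewrite deg mulr1.
  by rewrite prodr_const card_prod !card_ord.
have l_gt0 : (0 < l)%N by exact: (ltn_trans _ l_gt2).
(* [y] is the weight of a vertex shared by neighbouring petals, [z] that of the whole center; the
   signs come from the subtraction from [1%:M]. *)
pose y := - ((a + x^-1) / (x + a * 2)).
pose z := - ((a + x^-1) * s%:R / (x + a * l%:R)).
have := det_circulant (1 - (a + x^-1) * (2 / (x + a * 2) + t%:R / (x + a))) y z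
  (cis_unity R l_gt0) (@cis_primitive R l).
under eq_bigr do rewrite cis_beta /y /z mulNr !mulNrn.
move=> <-; congr (\det _); apply/matrixP => i j; rewrite !mxE !big_sumType /=.
have center_sum : \sum_(w < s)
    (x + a * (codegree (inl (inl w) : hyperflower s t l l_gt2)
      (inl (inl w)))%:R)^-1
    * ((inl (inl w) \in petal s t i)%:R * (inl (inl w) \in petal s t j)%:R)
    = s%:R / (x + a * l%:R).
  under eq_bigr => w _ do rewrite deg -/(center_vertex t l w) !center_mem_petal
    !mulr1.
  by rewrite sumr_const card_ord mulr_natl.
have shared_sum : \sum_(v < l)
    (x + a * (codegree (inl (inr v) : hyperflower s t l l_gt2)
      (inl (inr v)))%:R)^-1
    * ((inl (inr v) \in petal s t i)%:R * (inl (inr v) \in petal s t j)%:R)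
    = ((i == j)%:R * 2 + (ordS i == j)%:R + (i == ordS j)%:R) / (x + a * 2).
  (* The two shared vertices of a petal are distinct, so the disjunction becomes a sum, and the
     product for two petals splits into four Kronecker deltas. *)
  have ends (v p : 'I_l) :
      ((v == p) || (v == ordS p))%:R = (v == p)%:R + (v == ordS p)%:R :> R[i].
    case: (eqVneq v p) => [->|_]; last by rewrite add0r.
    by rewrite eq_sym (negPf (ordS_neq _ _)) ?addr0 // ltnW.
  set c := (x + a * 2)^-1.
  under eq_bigr => v _.
    rewrite deg -/(shared_vertex s t v) !shared_mem_petal !ends.
    rewrite -/c mulrDl !mulrDr; over.
  rewrite !big_split /= -!big_distrr /= !sum_delta.
  by rewrite (inj_eq (bij_inj (ordS_bij l))); ring.
have twin_sum : \sum_(u : 'I_t * 'I_l)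
    (x + a * (codegree (inr u : hyperflower s t l l_gt2) (inr u))%:R)^-1
    * ((inr u \in petal s t i)%:R * (inr u \in petal s t j)%:R)
    = (i == j)%:R * t%:R / (x + a).
  transitivity (\sum_(p < t) \sum_(q < l) (x + a)^-1 *
    ((q == i)%:R * (q == j)%:R)).
    rewrite pair_bigA; apply: eq_bigr => -[p q] _.
    by rewrite deg mulr1 -/(twin_vertex s p q) !twin_mem_petal.
  under eq_bigr do rewrite -big_distrr /= sum_delta.
  by rewrite sumr_const card_ord -mulr_natr; ring.
rewrite center_sum shared_sum twin_sum.
by rewrite -[(1 - _) *+ _]mulr_natr -![y *+ _]mulr_natr /y /z; ring.
Qed.

(** * Assembly of the spectrum *)

Theorem theorem5 (R : realType) (s t l : nat)
    (s_gt0 : (0 < s)%N) (t_gt0 : (0 < t)%N) (l_gt2 : (2 < l)%N) :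
  let k := (s + t + 2)%N in
  let F := hyperflower s t l l_gt2 in
  perm_eq (spectrum (adjacency R k (subdivision F)))
    (nseq (l * (t - 1)) (- ((k%:R - 2) / (k%:R - 1)) : R)%:C
     ++ nseq (s - 1) (- (l%:R * (k%:R - 2) / (k%:R - 1)) : R)%:C
     ++ complex_roots (quartic s%:R t%:R l%:R)
     ++ flatten [seq complex_roots (cubic s%:R t%:R (beta R l j))
                | j <- index_iota 1 l]).
Proof.
lazy zeta; set k := (s + t + 2)%N; set F := hyperflower _ _ _ _.
have kE : k%:R = s%:R + t%:R + 2 :> R by rewrite /k !natrD.
have kEC : k%:R = s%:R + t%:R + 2 :> R[i] by rewrite /k !natrD.
have k1 : s%:R + t%:R + 2 - 1 != 0 :> R.
  by rewrite -kE subr_eq0 -[eqbRHS](mulr1n 1) eqr_nat /k addn2.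
have k1C : s%:R + t%:R + 2 - 1 != 0 :> R[i].
  by rewrite -kEC subr_eq0 -[eqbRHS](mulr1n 1) eqr_nat /k addn2.
pose a : R[i] := (k%:R - 2) / (k%:R - 1).
have aE : ((k%:R - 2) / (k%:R - 1) : R)%:C = a.
  by rewrite fmorph_div !rmorphB /= !rmorph_nat.
have alE : (l%:R * (k%:R - 2) / (k%:R - 1) : R)%:C = a * l%:R.
  by rewrite -mulrA rmorphM /= aE rmorph_nat mulrC.
have aST : (s%:R + t%:R + 2 - 2) / (s%:R + t%:R + 2 - 1) = a by rewrite /a kEC.
have k1exp n : ((s%:R + t%:R + 2 - 1 : R) ^+ n)^-1%:C
    = (s%:R + t%:R + 2 - 1) ^- n :> R[i].
  by rewrite -kE -kEC fmorphV rmorphXn rmorphB /= rmorph_nat.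
(* Equality of multisets of roots is reduced to equality of monic polynomials. *)
apply: prod_XsubC_eq.
rewrite prod_complex_roots ?monic_neq0 ?char_poly_monic //.
rewrite (monicP (char_poly_monic _)) invr1 scale1r !big_cat /= !big_nseq
  !iter_mulr_1.
rewrite big_flatten big_map prod_complex_roots; last first.
  by rewrite -lead_coef_eq0 lead_coef_quartic // expf_neq0.
under eq_bigr => j _.
  rewrite prod_complex_roots;
    last by rewrite -lead_coef_eq0 lead_coef_cubic // expf_neq0.
  rewrite lead_coef_cubic // k1exp; over.
rewrite lead_coef_quartic // k1exp !(rmorphN (real_complex R)) /= aE alE.
(* The excluded values are 0 and the opposites of [a] times a vertex degree: the poles of the
   determinant formula. *)
apply: (@poly_eq_away _ [:: 0; - (a * l%:R); - (a * 2); - a]) => x.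
rewrite !inE !negb_or -!addr_eq0 => /and4P[x0 xl x2 x1].
rewrite horner_char_poly_hyperflower // -/a.
rewrite !hornerM !horner_exp !hornerXsubC !opprK !hornerZ horner_prod.
rewrite horner_quartic // !rmorph_nat ?aST // mulKf ?expf_neq0 //.
pose g j := 1 - (a + x^-1) * (2 / (x + a * 2) + t%:R / (x + a))
       - (a + x^-1) / (x + a * 2) * (beta R l j)%:C.
transitivity ((x + a) ^+ (l * (t - 1)) * ((x + a * l%:R) ^+ (s - 1) *
  (x * (x + a * l%:R) * (x + a * 2) * (x + a)
   * (g 0%N - (a + x^-1) * s%:R / (x + a * l%:R) * l%:R)
  * \prod_(1 <= j < l) (x * (x + a * 2) * (x + a) * g j)))); last first.
  congr (_ * (_ * (_ * _))).
    (* At [j = 0] the cosine is 1, so [beta] is the constant 2 of [horner_quartic]. *)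
    by rewrite /g /beta !(mulr0, mul0r) cos0 mulr1 rmorph_nat.
  apply: eq_bigr => j _.
  by rewrite hornerZ horner_cubic // !rmorph_nat ?aST // mulKf ?expf_neq0.
set h := (a + x^-1) * s%:R / _.
rewrite -(big_mkord xpredT (fun j => g j - h *+ l *+ (j == 0%N))).
rewrite big_ltn ?(ltn_trans _ l_gt2) //= mulr1n -[h *+ l]mulr_natr.
rewrite big_split prodr_const_nat /=.
rewrite (eq_big_nat _ _ (F2 := g)) => [|[|j] // _];
  last by rewrite mulr0n subr0.
move: (\prod_(1 <= j < l) g j) (g 0%N - h * l%:R) => p q.
(* Of the [t * l] factors [x + a], the quartic absorbs one and the cubics [l - 1]; likewise the
   quartic takes one of the [s] factors [x + a * l%:R]. *)
have -> : (t * l = l * (t - 1) + (l - 1).+1)%N.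
  by rewrite !subn1 prednK ?(ltn_trans _ l_gt2) // -mulnSr prednK // mulnC.
have exprl (y : R[i]) : y ^+ l = y * y ^+ (l - 1).
  by rewrite -exprS subn1 prednK // (ltn_trans _ l_gt2).
have exprs (y : R[i]) : y ^+ s = y * y ^+ (s - 1) by rewrite -exprS subn1
  prednK.
by rewrite exprl exprs exprl exprD exprS !exprMn; ring.
Qed.
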